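(* Let $(\mathcal K,\varphi)$ be a complete idempotent reflexive semiring and let $X$ be a complete right $\mathcal K$-semimodule. Then for any continuous linear form $f\in X'$ there is $x\in X$ such that $$f(y)={}^-x(y)=\varphi/(y\backslash x)\quad\text{for all }y\in X,$$ and the unique $x\in X$ satisfying this is $x=f^-$.
   Context: A semiring $(\mathcal K,\oplus,\otimes,\varepsilon,e)$ is idempotent if $a\oplus a=a$ for all $a$. An idempotent commutative monoid carries the natural order $a\le b\iff a\oplus b=b$. An ordered set is complete if every subset $U$ has a least upper bound $\bigvee U$. A map $f$ between complete ordered sets is continuous if $f(\bigvee U)=\bigvee f(U)$ for every subset $U$ (including $U=\varnothing$). An idempotent semiring is complete if it is complete for its natural order and all its left and right multiplications are continuous. A right $\mathcal K$-semimodule is a commutative monoid $(X,\oplus,\varepsilon)$ with a right action satisfying $x(\lambda\mu)=(x\lambda)\mu$, $(x\oplus y)\lambda=x\lambda\oplus y\lambda$, $x(\lambda\oplus\mu)=x\lambda\oplus x\mu$, $x\varepsilon=\varepsilon$, $xe=x$; its addition is then idempotent. It is complete if it is complete for its natural order and the maps $x\mapsto x\lambda$ on $X$ and $\mu\mapsto v\mu$ from $\mathcal K$ to $X$ are all continuous. A map is linear if it preserves finite sums and commutes with the action. For $x,y\in X$, $y\backslash x=\max\{\lambda\in\mathcal K\mid y\lambda\le x\}$. For $\lambda\in\mathcal K$: $\lambda\backslash\varphi=\max\{\mu\in\mathcal K\mid\lambda\mu\le\varphi\}$ and $\varphi/\lambda=\max\{\mu\in\mathcal K\mid\mu\lambda\le\varphi\}$.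 $(\mathcal K,\varphi)$ is reflexive if $\varphi/(\lambda\backslash\varphi)=\lambda$ (left reflexive) and $(\varphi/\lambda)\backslash\varphi=\lambda$ (right reflexive) for all $\lambda\in\mathcal K$. $X'$ is the set of linear continuous maps $X\to\mathcal K$, with pointwise order and pointwise left action $(\lambda f)(x)=\lambda f(x)$, paired with $X$ by $\langle f\mid x\rangle=f(x)$. For $x\in X$, ${}^-x=\max\{f\in X'\mid f(x)\le\varphi\}$; for $f\in X'$, $f^-=\max\{x\in X\mid f(x)\le\varphi\}$. *)

(* Defs.v *)
From HB Require Import structures.
From mathcomp Require Import all_boot all_algebra.
From mathcomp Require Import boolp classical_sets.

Set Implicit Arguments.
Unset Strict Implicit.
Unset Printing Implicit Defensive.

Import GRing.Theory.

Local Open Scope classical_set_scope.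
Local Open Scope ring_scope.

Section NaturalOrder.

Definition natle (M : nmodType) (a b : M) : Prop := a + b = b.

Definition is_lub (M : nmodType) (U : set M) (b : M) : Prop :=
  (forall u, U u -> natle u b) /\
  (forall c, (forall u, U u -> natle u c) -> natle b c).

Definition complete_order (M : nmodType) : Prop :=
  forall U : set M, exists b, is_lub U b.

(* Between complete orders this is f (\/ U) = \/ f(U) for every U, including
   the empty set. *)
Definition sup_continuous (M N : nmodType) (f : M -> N) : Prop :=
  forall (U : set M) (b : M), is_lub U b -> is_lub (f @` U) (f b).

End NaturalOrder.

Section GreatestElement.

Definition is_max (T : Type) (le : T -> T -> Prop) (U : set T) (m : T) : Prop :=
  U m /\ forall u, U u -> le u m.

(* The default x0 is only returned when U has no greatest element. *)
Definition max_of (T : choiceType) (x0 : T) (le : T -> T -> Prop) (U : set T) :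
  T := xget x0 (is_max le U).

End GreatestElement.

Section Semiring.
Variable K : pzSemiRingType.

Definition idempotent_semiring : Prop := forall a : K, a + a = a.

Definition complete_idempotent_semiring : Prop :=
  [/\ idempotent_semiring,
      complete_order K,
      forall a : K, sup_continuous (fun b : K => a * b) &
      forall a : K, sup_continuous (fun b : K => b * a)].

(* a \ c *)
Definition ldiv (a c : K) : K :=
  max_of 0 (@natle K) [set m : K | natle (a * m) c].

(* c / a *)
Definition rdiv (c a : K) : K :=
  max_of 0 (@natle K) [set m : K | natle (m * a) c].

Definition left_reflexive (phi : K) : Prop :=
  forall l : K, rdiv phi (ldiv l phi) = l.

Definition right_reflexive (phi : K) : Prop :=
  forall l : K, ldiv (rdiv phi l) phi = l.

Definition reflexive_semiring (phi : K) : Prop :=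
  left_reflexive phi /\ right_reflexive phi.

End Semiring.

(* A right K-semimodule is a left semimodule over the converse semiring K^c:
   the product x l is written l *: x, and scalerA reads (x b) a = x (b a). *)
Section RightSemimodule.
Variables (K : pzSemiRingType) (X : lSemiModType K^c).

Definition complete_semimodule : Prop :=
  [/\ complete_order X,
      forall l : K, sup_continuous (fun x : X => (l : K^c) *: x) &
      forall v : X, sup_continuous (fun m : K => (m : K^c) *: v)].

(* y \ x *)
Definition mdiv (y x : X) : K :=
  max_of 0 (@natle K) [set l : K | natle ((l : K^c) *: y) x].

(* X': the scaling action on the codomain is the product of K^c, so scalability
   reads f (x l) = f x * l in K. *)
Definition dual : set (X -> K) :=
  [set f : X -> K | [/\ nmod_morphism f,
                        GRing.scalable_for (@GRing.mul K^c) f &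
                        sup_continuous f]].

Definition pointwise_le (f g : X -> K) : Prop := forall x, natle (f x) (g x).

(* ^-x *)
Definition conj_vec (phi : K) (x : X) : X -> K :=
  max_of (fun=> 0) pointwise_le [set f | dual f /\ natle (f x) phi].

(* f^- *)
Definition conj_form (phi : K) (f : X -> K) : X :=
  max_of 0 (@natle X) [set x : X | natle (f x) phi].

End RightSemimodule.

(* Main.v *)
(** Right and left reflexivity make [l |-> rdiv phi l] a bijection with inverse
    [l |-> ldiv l phi].  For a continuous linear form [f], put [x := f^-], so that
    [f z <= phi] iff [z <= x].  Taking [z = y l] and using linearity,
    [f y * l <= phi] iff [y l <= x]: that is, [f y \ phi = y \ x], hence
    [f y = phi / (y \ x)] by left reflexivity.  Any [g] in the dual with
    [g x <= phi] lies below [phi / (y \ x)] at [y], whence [f = ^-x]; no separate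
    proof that [y |-> phi / (y \ x)] is linear and continuous is needed.
    Conversely, if [f = phi / (- \ x)] then [f y \ phi = y \ x] by right
    reflexivity; testing against the unit, [f y <= phi] iff [y <= x], which
    determines [x]. *)
Require Import Defs.
From HB Require Import structures.
From mathcomp Require Import all_boot all_algebra.
From mathcomp Require Import boolp classical_sets.

Set Implicit Arguments.
Unset Strict Implicit.
Unset Printing Implicit Defensive.

Import GRing.Theory.

Local Open Scope classical_set_scope.
Local Open Scope ring_scope.

Lemma natle_trans (M : nmodType) (b a c : M) :
  natle a b -> natle b c -> natle a c.
Proof. by rewrite /natle => ab bc; rewrite -bc addrA ab. Qed.

Lemma natle_anti (M : nmodType) (a b : M) : natle a b -> natle b a -> a = b.
Proof. by rewrite /natle => ab ba; rewrite -ba addrC ab. Qed.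

(** Idempotency makes [natle] reflexive, so testing at [m = a] and [m = b] gives both
    inequalities. *)
Lemma natle_eqP (M : nmodType) (a b : M) : (forall m : M, m + m = m) ->
  (forall m, natle m a <-> natle m b) -> a = b.
Proof. by move=> idM ab; apply: natle_anti; apply/ab; apply: idM. Qed.

Lemma max_of_eq (T : choiceType) (x0 : T) (le : T -> T -> Prop) (U : set T) m :
  (forall a b, le a b -> le b a -> a = b) ->
  is_max le U m -> max_of x0 le U = m.
Proof.
move=> anti [Um ub]; apply: xget_unique => // n [Un ubn].
by apply: anti; [apply: ub | apply: ubn].
Qed.

(** When [a] is below [b], the least upper bound of [[set a; b]] is [b], and [h] preserves it. *)
Lemma sup_continuous_homo (M N : nmodType) (h : M -> N) :
  (forall m : M, m + m = m) -> sup_continuous h ->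
  forall a b, natle a b -> natle (h a) (h b).
Proof.
move=> idM hc a b ab.
have lub_b : is_lub [set a; b] b.
  split; first by move=> u [->|->] //; apply: idM.
  by move=> c; apply; right.
by have [+ _] := hc _ _ lub_b; apply; exists a => //; left.
Qed.

(** Continuity keeps the supremum of the sublevel set inside that set, so the maximum is attained
    and the default [0] never occurs. Every residuation below is an instance. *)
Lemma sup_continuous_adj (M N : nmodType) (h : M -> N) (c : N) (m : M) :
  (forall m : M, m + m = m) -> complete_order M -> sup_continuous h ->
  natle m (max_of 0 (@natle M) [set m | natle (h m) c]) <-> natle (h m) c.
Proof.
move=> idM cM hc; have [b lub_b] := cM [set m | natle (h m) c].
have hbc : natle (h b) c.
  by have [_] := hc _ _ lub_b; apply => _ [u hu <-].
have -> : max_of 0 (@natle M) [set m | natle (h m) c] = b.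
  by apply: max_of_eq; [exact: natle_anti | split => //; case: lub_b].
split=> [mb|]; last by case: lub_b => + _; apply.
exact: natle_trans (sup_continuous_homo idM hc mb) hbc.
Qed.

Lemma semimodule_idem (K : pzSemiRingType) (X : lSemiModType K^c) :
  idempotent_semiring K -> forall x : X, x + x = x.
Proof.
by move=> idK x; rewrite -[x](scale1r x) -scalerDl; congr (_ *: _); apply: idK.
Qed.

Section Adjunctions.
Variables (K : pzSemiRingType) (hK : complete_idempotent_semiring K).

Lemma natle_ldiv (a c l : K) : natle l (ldiv a c) <-> natle (a * l) c.
Proof. by case: hK => idK cK lc _; apply: (sup_continuous_adj (h := *%R a)). Qed.

Lemma natle_rdiv (a c l : K) : natle l (rdiv c a) <-> natle (l * a) c.
Proof. by case: hK => idK cK _ rc; apply: (sup_continuous_adj (h := *%R^~ a)). Qed.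

Variables (X : lSemiModType K^c) (hX : complete_semimodule X).

Lemma natle_mdiv (y x : X) (l : K) :
  natle l (mdiv y x) <-> natle ((l : K^c) *: y) x.
Proof.
case: hK hX => idK cK _ _ [_ _ cont].
exact: (sup_continuous_adj (h := fun m : K => (m : K^c) *: y)).
Qed.

Lemma natle_conj_form (phi : K) (f : X -> K) (x : X) : dual f ->
  natle x (conj_form phi f) <-> natle (f x) phi.
Proof.
case: hK hX => idK _ _ _ [cX _ _] [_ _ fc].
exact: sup_continuous_adj (semimodule_idem idK) cX fc.
Qed.

(** By residuation and linearity the claim is that [g] maps [y (y \ x)] below [phi]; this vector
    lies below [x], and [g] is monotone. *)
Lemma dual_le_rdiv_mdiv (phi : K) (g : X -> K) (x y : X) :
  dual g -> natle (g x) phi -> natle (g y) (rdiv phi (mdiv y x)).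
Proof.
have [idK _ _ _] := hK => -[_ gZ gc] gx.
apply/natle_rdiv; have -> : g y * mdiv y x = g ((mdiv y x : K^c) *: y).
  by rewrite gZ.
apply: natle_trans gx; apply: sup_continuous_homo gc _ _ _.
  exact: semimodule_idem.
by apply/natle_mdiv; apply: idK.
Qed.

Lemma ldiv_dual (phi : K) (f : X -> K) (y : X) : dual f ->
  ldiv (f y) phi = mdiv y (conj_form phi f).
Proof.
have [idK _ _ _] := hK => fd; apply: natle_eqP => // l.
have [_ fZ _] := fd.
have fyl : f y * l = f ((l : K^c) *: y) by rewrite fZ.
by rewrite natle_ldiv natle_mdiv natle_conj_form // fyl.
Qed.

End Adjunctions.

Theorem corollary39 (K : pzSemiRingType) (phi : K)
    (hK : complete_idempotent_semiring K) (hphi : reflexive_semiring phi)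
    (X : lSemiModType K^c) (hX : complete_semimodule X)
    (f : X -> K) (hf : dual f) :
  (exists x : X, forall y : X,
      f y = conj_vec phi x y /\ conj_vec phi x y = rdiv phi (mdiv y x)) /\
  (forall x : X,
      (forall y : X,
         f y = conj_vec phi x y /\ conj_vec phi x y = rdiv phi (mdiv y x)) ->
      x = conj_form phi f).
Proof.
have [lrefl rrefl] := hphi; have [idK _ _ _] := hK.
have idX : forall x : X, x + x = x := semimodule_idem idK.
split.
  exists (conj_form phi f) => y.
  have fE z : f z = rdiv phi (mdiv z (conj_form phi f)).
    by rewrite -(ldiv_dual hK hX) // lrefl.
  suff -> : conj_vec phi (conj_form phi f) = f by rewrite -fE.
  apply: max_of_eq.
    by move=> g h gh hg; apply/funext => z; apply: natle_anti.
  split=> [|g [gd gx] z]; last by rewrite fE; apply: dual_le_rdiv_mdiv.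
  (* [f] itself is a candidate: the adjunction at [f^-] turns [f (f^-) <= phi] into reflexivity. *)
  by split=> //; apply/(natle_conj_form hK hX) => //; apply: idX.
move=> x xP; apply: natle_eqP => // y.
have fE : f y = rdiv phi (mdiv y x) by have [-> ->] := xP y.
have divE : ldiv (f y) phi = mdiv y x by rewrite fE rrefl.
rewrite (natle_conj_form hK hX) // -[f y]mulr1 -(natle_ldiv hK) divE.
by rewrite (natle_mdiv hK hX) scale1r.
Qed.
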